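(* Suppose $g$ is Lipschitz continuous with Lipschitz coefficient $\beta$, i.e. $\|g(\vec c_1)-g(\vec c_2)\|_{\mathcal F}\le\beta\|\vec c_1-\vec c_2\|_{\mathcal J}$ for all $\vec c_1,\vec c_2\in\mathbb R^L$, and suppose that the map $\hat T(\vec f)=g(C(\vec f)+\vec J)$, $\vec f\in\mathcal F$, is a contraction with parameter $\alpha$ (for every link incentive $\vec J$), i.e. $\alpha\in[0,1)$ and $\|\hat T(\vec f_1)-\hat T(\vec f_2)\|_{\mathcal F}\le\alpha\|\vec f_1-\vec f_2\|_{\mathcal F}$ for all $\vec f_1,\vec f_2\in\mathcal F$. Let $h(\vec J)$ denote the fixed point of $\hat T$ (the equilibrium flow under $\vec J$). Then $h$ is Lipschitz continuous with Lipschitz coefficient $\frac{\beta}{1-\alpha}$: $$\|h(\vec J_1)-h(\vec J_2)\|_{\mathcal F}\le\frac{\beta}{1-\alpha}\,\|\vec J_1-\vec J_2\|_{\mathcal J}\qquad\text{for all link incentives }\vec J_1,\vec J_2\in\mathbb R^L .$$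
   Context: There are $L$ links and $M$ routes (hyperpaths). $B=(b_{lm})\in[0,1]^{L\times M}$ is the link-route matrix, with $b_{lm}$ the probability that route $m$ traverses link $l$. The link cost function is $C:\mathbb R^L\to\mathbb R^L$. The route utility function is $V(\vec c)=-b\,B^{T}\vec c-\vec c_s$ with constants $b\ge0$, $\vec c_s\in\mathbb R^M$. With $\epsilon_1,\dots,\epsilon_M$ independent random variables with a common density (unobserved utilities; Gumbel in the logit case), the route choice function is $P(\vec v)=(p_1(\vec v),\dots,p_M(\vec v))^T$, $p_m(\vec v)=\mathrm{Prob}(v_m+\epsilon_m>v_j+\epsilon_j\ \forall j\neq m)$, and the satisfaction function is $S(\vec v)=\mathbb E[\max_m(v_m+\epsilon_m)]$. The elastic demand function is $D:\mathbb R\to[0,\hat d_{\max}]$, with $\hat d_{\max}>0$ constant. The set of feasible link flows is $\mathcal F=\{B\vec x:\vec x\in\mathbb R^M,\ \vec x\ge0,\ \sum_m x_m\in[0,\hat d_{\max}]\}$. The traffic assignment function is $g:\mathbb R^L\to\mathcal F$, $g(\vec c)=B\,P(V(\vec c))\,D(S(V(\vec c)))$. $\|\cdot\|_{\mathcal F}$ and $\|\cdot\|_{\mathcal J}$ are norms on $\mathbb R^L$, used for link flows and for link costs/incentives respectively. Link incentives are vectors $\vec J\in\mathbb R^L$. *)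

(* Defs.v *)
(* MathComp-Analysis: the reals are an arbitrary R : realType; vectors of R^n are
   column vectors 'cV[R]_n. *)
From HB Require Import structures.
From mathcomp Require Import all_boot all_order all_algebra.
From mathcomp Require Import all_classical all_reals all_analysis.

Set Implicit Arguments.
Unset Strict Implicit.
Unset Printing Implicit Defensive.

Import Order.TTheory GRing.Theory Num.Theory.
Import numFieldNormedType.Exports.

Local Open Scope classical_set_scope.
Local Open Scope ring_scope.

(* Two different norms live on the same space R^L, and neither need be the sup norm
   that is canonical on matrices: hence a predicate rather than a normed-space
   structure. *)
Record is_norm (R : realType) (n : nat) (N : 'cV[R]_n -> R) : Prop := IsNorm {
  is_norm_triangle : forall x y, N (x + y) <= N x + N y;
  is_norm_scale : forall (a : R) x, N (a *: x) = `|a| * N x;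
  is_norm_eq0 : forall x, N x = 0 -> x = 0
}.

Section RandomUtility.
Context (R : realType) (d : measure_display) (Omega : measurableType d).
Context (Pr : probability Omega R) (M : nat) (eps : 'I_M -> {RV Pr >-> R}).

Definition mutually_independent : Prop :=
  forall (I : {set 'I_M}) (A : 'I_M -> set R),
    (forall m, measurable (A m)) ->
    Pr (\bigcap_(m in [set` I]) (eps m @^-1` A m)) =
    (\big[*%E/1%E]_(m in I) Pr (eps m @^-1` A m))%E.

Definition have_common_density : Prop :=
  exists rho : R -> R,
    [/\ measurable_fun setT rho,
        forall x, 0 <= rho x &
        forall (m : 'I_M) (A : set R), measurable A ->
          distribution Pr (eps m) A =
          (\int[lebesgue_measure]_(x in A) (rho x)%:E)%E].

Definition route_choice (v : 'cV[R]_M) : 'cV[R]_M :=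
  \col_m fine (Pr [set w | forall j : 'I_M, j != m ->
                            v m 0 + eps m w > v j 0 + eps j w]).

(* The maximum is taken in \bar R only so that it needs no default real value; it is
   finite as soon as 0 < M. The final fine makes the expectation a total real-valued
   function, with value 0 when the expectation is infinite or undefined. *)
Definition satisfaction (v : 'cV[R]_M) : R :=
  fine (\int[Pr]_w \big[maxe/-oo]_(m < M) (v m 0 + eps m w)%:E)%E.

End RandomUtility.

Definition route_utility (R : realType) (L M : nat) (B : 'M[R]_(L, M))
    (b : R) (cs : 'cV[R]_M) (c : 'cV[R]_L) : 'cV[R]_M :=
  - b *: (B^T *m c) - cs.

Definition feasible_flows (R : realType) (L M : nat) (B : 'M[R]_(L, M))
    (dmax : R) : set 'cV[R]_L :=
  [set B *m x | x in [set x : 'cV[R]_M |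
     (forall m, 0 <= x m 0) /\ 0 <= \sum_m x m 0 <= dmax]].

Definition traffic_assignment (R : realType) (d : measure_display)
    (Omega : measurableType d) (Pr : probability Omega R) (L M : nat)
    (B : 'M[R]_(L, M)) (b : R) (cs : 'cV[R]_M) (eps : 'I_M -> {RV Pr >-> R})
    (D : R -> R) (c : 'cV[R]_L) : 'cV[R]_L :=
  let v := route_utility B b cs c in
  D (satisfaction eps v) *: (B *m route_choice eps v).

Definition incentive_map (R : realType) (L : nat) (g C : 'cV[R]_L -> 'cV[R]_L)
    (J f : 'cV[R]_L) : 'cV[R]_L :=
  g (C f + J).

(* xget picks the fixed point; its default value 0 is returned only if there is
   no fixed point in F. *)
Definition equilibrium_flow (R : realType) (L : nat) (F : set 'cV[R]_L)
    (g C : 'cV[R]_L -> 'cV[R]_L) (J : 'cV[R]_L) : 'cV[R]_L :=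
  xget 0 [set f | F f /\ incentive_map g C J f = f].

(* Main.v *)
(* The feasible flows are the image of a compact set under the linear map B, and
   f |-> normF (T f - f) is continuous on them because T is a contraction. Its
   minimizer f is a fixed point: otherwise T f would give a strictly smaller value.
   If f1 and f2 are the equilibria under J1 and J2, then
   f1 - f2 = (T1 f1 - T1 f2) + (T1 f2 - T2 f2) has norm at most
   alpha * normF (f1 - f2) + beta * normJ (J1 - J2). *)
Require Import Defs.
From HB Require Import structures.
From mathcomp Require Import all_boot all_order all_algebra.
From mathcomp Require Import all_classical all_reals all_analysis.
From mathcomp Require Import measurable_realfun lra.

Set Implicit Arguments.
Unset Strict Implicit.
Unset Printing Implicit Defensive.

Import Order.TTheory GRing.Theory Num.Theory.
Import numFieldNormedType.Exports.

Local Open Scope classical_set_scope.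
Local Open Scope ring_scope.

Section Norms.
Context (R : realType) (n : nat) (N : 'cV[R]_n -> R) (hN : is_norm N).

Lemma is_norm0 : N 0 = 0.
Proof. by rewrite -(scale0r 0) (is_norm_scale hN) normr0 mul0r. Qed.

Lemma is_normN x : N (- x) = N x.
Proof. by rewrite -scaleN1r (is_norm_scale hN) normrN1 mul1r. Qed.

Lemma is_norm_ge0 x : 0 <= N x.
Proof.
have := is_norm_triangle hN x (- x).
by rewrite subrr is_norm0 is_normN -mulr2n pmulrn_lge0.
Qed.

Lemma is_norm_dist_triangle x y z : N (x - z) <= N (x - y) + N (y - z).
Proof. by rewrite -(subrKA y) (is_norm_triangle hN). Qed.

(** [A *m x^T] is the combination of the columns of [A] with coefficients the entries of [x], each
    at most the sup norm of [x]. This bound links the abstract norm [N] to the canonical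
    topology. *)
Lemma is_norm_mulmx_bounded m (A : 'M[R]_(n, m)) :
  exists2 K : R, 0 <= K & forall x : 'rV[R]_m, N (A *m x^T) <= K * `|x|.
Proof.
exists (\sum_i N (col i A)); first by apply: sumr_ge0 => i _; exact: is_norm_ge0.
move=> x; rewrite -[A *m _]trmxK trmx_mul trmxK mulmx_sum_row raddf_sum /=.
have NsumE (F : 'I_m -> 'cV[R]_n) : N (\sum_i F i) <= \sum_i N (F i).
  elim/big_ind2 : _ => [|a b c e ab ce|//]; first by rewrite is_norm0.
  by rewrite (le_trans (is_norm_triangle hN _ _)) ?lerD.
rewrite (le_trans (NsumE _))// mulr_suml ler_sum// => i _.
rewrite linearZ /= tr_row trmxK (is_norm_scale hN) mulrC ler_wpM2l ?is_norm_ge0//.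
rewrite [leRHS]/Num.norm /= mx_normrE.
exact: (le_bigmax _ (fun j => `|x j.1 j.2|) (ord0, i)).
Qed.

(** The minimization is carried out on [X], after composing with [A]: compactness and continuity
    refer to the topology of row vectors, and [N] needs none of its own. *)
Lemma contraction_fixpoint_compact m (A : 'M[R]_(n, m)) (X : set 'rV[R]_m)
    (T : 'cV[R]_n -> 'cV[R]_n) (alpha : R) (F := [set A *m x^T | x in X]) :
  compact X -> X !=set0 -> (forall f, F f -> F (T f)) -> 0 <= alpha < 1 ->
  (forall f1 f2, F f1 -> F f2 -> N (T f1 - T f2) <= alpha * N (f1 - f2)) ->
  exists2 f, F f & T f = f.
Proof.
move=> cX X0 FT /andP[alpha0 alpha1] Tcontr.
pose disp (f : 'cV[R]_n) := N (T f - f).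
(* Passing through [T f2] and [f2] gives the factor [alpha + 1], which is below 2. *)
have disp_le f1 f2 : F f1 -> F f2 -> disp f1 - disp f2 <= 2 * N (f1 - f2).
  move=> Ff1 Ff2; rewrite lerBlDr.
  apply: (le_trans (is_norm_dist_triangle _ (T f2) _)).
  have := is_norm_dist_triangle (T f2) f2 f1; rewrite -(is_normN (f2 - f1)) opprB.
  have := Tcontr _ _ Ff1 Ff2; have := is_norm_ge0 (f1 - f2); rewrite /disp; nra.
have [K K0 AK] := is_norm_mulmx_bounded A.
(* [K + 1] replaces [K] because [K] may be 0 and the radius below divides by it. *)
have K2 : 0 < 2 * (K + 1) by lra.
have disp_cont : {within X, continuous (fun x => disp (A *m x^T))}.
  apply/subspace_continuousP => x Xx; apply/cvgrPdist_le => e e0; near=> y.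
  have Xy : X y by near: y; exact: withinT.
  have Kxy : 2 * (K * `|x - y|) <= e.
    have : `|x - y| <= e / (2 * (K + 1)).
      near: y; apply: cvg_within.
      have /cvgrPdist_le := @cvg_id _ (nbhs x); apply; exact: divr_gt0.
    rewrite ler_pdivlMr//; have := normr_ge0 (x - y); nra.
  have NA u v : N (A *m u^T - A *m v^T) <= K * `|u - v|.
    by rewrite -mulmxBr -linearB; exact: AK.
  have Fx : F (A *m x^T) by exists x.
  have Fy : F (A *m y^T) by exists y.
  change (`|disp (A *m x^T) - disp (A *m y^T)| <= e).
  have := disp_le _ _ Fx Fy; have := disp_le _ _ Fy Fx.
  have := NA x y; have := NA y x; rewrite (distrC y x) ler_norml; lra.
have [x /set_mem Xx minx] := EVT_min_rV X0 cX disp_cont.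
have Fx : F (A *m x^T) by exists x.
exists (A *m x^T) => //; apply/eqP; rewrite -subr_eq0; apply/eqP.
apply: (is_norm_eq0 hN).
(* Minimality is known over [X], so [T f] is first written as the image of some [y]. Then
   [disp f <= disp (T f) <= alpha * disp f] with [alpha < 1] forces [disp f = 0]. *)
have [y Xy Ty] := FT _ Fx.
have := minx y (mem_set Xy); rewrite /= Ty.
have := Tcontr _ _ (FT _ Fx) Fx; rewrite -/(disp _) -/(disp (A *m x^T)).
have := is_norm_ge0 (T (A *m x^T) - A *m x^T); rewrite -/(disp _).
nra.
Unshelve. all: by end_near. Qed.

End Norms.

Section RouteChoice.
Context (R : realType) (d : measure_display) (Omega : measurableType d).
Context (Pr : probability Omega R) (M : nat) (eps : 'I_M -> {RV Pr >-> R}).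

Lemma route_choice_ge0 v m : 0 <= route_choice eps v m 0.
Proof. by rewrite mxE fine_ge0. Qed.

(* Only an inequality: without a density, ties may have positive probability. *)
Lemma sum_route_choice_le1 v : \sum_m route_choice eps v m 0 <= 1.
Proof.
pose E m := [set w | forall j : 'I_M, j != m ->
  v m 0 + eps m w > v j 0 + eps j w].
have mE m : measurable (E m).
  rewrite (_ : E m = \bigcap_(j in [set j | j != m])
      ((fun w => v j 0 + eps j w < v m 0 + eps m w) @^-1` [set true])).
    apply: fin_bigcap_measurable => [|j _]; first exact: finite_finset.
    rewrite -[X in measurable X]setTI; apply: measurable_fun_ltr => //;
      exact: measurable_funD.
  by apply/seteqP; split.
(* Two distinct routes cannot each be strictly better than the other, so the probabilities add up to
   that of a union. *)
have tE : trivIset [set: 'I_M] E.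
  apply/trivIsetP => i j _ _ ij; rewrite -subset0 => w [/(_ j) Ei /(_ i ij) Ej].
  by have := Ei; rewrite eq_sym ij => /(_ isT); rewrite ltNge (ltW Ej).
rewrite -lee_fin -sumEFin.
rewrite [leLHS](_ : _ = \sum_(m < M) Pr (E m))%E; last first.
  by apply: eq_bigr => m _; rewrite mxE (fineK (fin_num_measure Pr _ (mE m))).
rewrite -measure_bigsetU_ord//; apply: probability_le1.
exact: bigsetU_measurable.
Qed.

End RouteChoice.

Lemma feasible_flowsE (R : realType) (L M : nat) (B : 'M[R]_(L, M)) (dmax : R) :
  feasible_flows B dmax =
  [set B *m x^T | x in [set x : 'rV[R]_M |
     (forall m, 0 <= x 0 m) /\ 0 <= \sum_m x 0 m <= dmax]].
Proof.
apply/seteqP; split=> [_ [x [x0 xs] <-]|_ [x [x0 xs] <-]]; exists x^T.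
- by split=> [m|] /=; [rewrite mxE|under eq_bigr do rewrite mxE].
- by rewrite trmxK.
- by split=> [m|] /=; [rewrite mxE|under eq_bigr do rewrite mxE].
- by [].
Qed.

(** A nonnegative entry is at most the sum of all entries, so the set is a closed part of the cube
    with side [[0, dmax]]. *)
Lemma compact_route_flows (R : realType) (M : nat) (dmax : R) :
  compact [set x : 'rV[R]_M |
    (forall m, 0 <= x 0 m) /\ 0 <= \sum_m x 0 m <= dmax].
Proof.
have csum : continuous (fun x : 'rV[R]_M => \sum_m x 0 m).
  apply: continuous_big => [|m _]; last exact: coord_continuous.
  exact: add_continuous.
rewrite (_ : mkset _ = [set x : 'rV[R]_M | forall m, `[0, dmax]%classic (x 0 m)]
    `&` (fun x : 'rV[R]_M => \sum_m x 0 m) @^-1` `[0, dmax]%classic).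
  apply: compact_closedI.
    apply: (@rV_compact R M (fun=> `[0, dmax]%classic)) => _.
    exact: segment_compact.
  by apply: preimage_closed => [x _|]; [exact: csum|exact: itv_closed].
apply/seteqP; split=> x /=; rewrite !in_itv /=; last first.
  by move=> [x0 ->]; split=> // m; have /andP[] := x0 m.
move=> [x0 xs]; split=> // m; rewrite in_itv /= x0 /=.
case/andP: xs => _; apply: le_trans.
by rewrite (bigD1 m)//= lerDl sumr_ge0.
Qed.

(** The route flows are the choice probabilities scaled by the demand; as these sum to at most 1,
    the total stays below [dmax]. *)
Lemma traffic_assignment_feasible (R : realType) (L M : nat) (B : 'M[R]_(L, M))
    (b : R) (cs : 'cV[R]_M) (d : measure_display) (Omega : measurableType d)
    (Pr : probability Omega R) (eps : 'I_M -> {RV Pr >-> R}) (dmax : R)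
    (D : R -> R) (hD : forall s, 0 <= D s <= dmax) (c : 'cV[R]_L) :
  feasible_flows B dmax (traffic_assignment B b cs eps D c).
Proof.
rewrite /traffic_assignment; set v := route_utility _ _ _ _; set s := satisfaction _ _.
have /andP[D0 Dmax] := hD s.
have p0 m : 0 <= (D s *: route_choice eps v) m 0.
  by rewrite mxE mulr_ge0// route_choice_ge0.
exists (D s *: route_choice eps v); last by rewrite scalemxAr.
split=> //; rewrite sumr_ge0//=.
under eq_bigr do rewrite mxE.
rewrite -mulr_sumr (le_trans _ Dmax)// ler_piMr//.
exact: sum_route_choice_le1.
Qed.

Theorem proposition2 (R : realType) (L M : nat)
  (B : 'M[R]_(L, M)) (hB : forall l m, 0 <= B l m <= 1)
  (C : 'cV[R]_L -> 'cV[R]_L)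
  (b : R) (hb : 0 <= b) (cs : 'cV[R]_M)
  (d : measure_display) (Omega : measurableType d) (Pr : probability Omega R)
  (eps : 'I_M -> {RV Pr >-> R})
  (eps_indep : mutually_independent eps)
  (eps_density : have_common_density eps)
  (dmax : R) (hdmax : 0 < dmax)
  (D : R -> R) (hD : forall s, 0 <= D s <= dmax)
  (normF normJ : 'cV[R]_L -> R)
  (hnormF : is_norm normF) (hnormJ : is_norm normJ)
  (alpha beta : R) :
  let F := feasible_flows B dmax in
  let g := traffic_assignment B b cs eps D in
  let T := incentive_map g C in
  let h := equilibrium_flow F g C in
  (forall c1 c2 : 'cV[R]_L, normF (g c1 - g c2) <= beta * normJ (c1 - c2)) ->
  0 <= alpha < 1 ->
  (forall J f1 f2 : 'cV[R]_L, F f1 -> F f2 ->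
     normF (T J f1 - T J f2) <= alpha * normF (f1 - f2)) ->
  forall J1 J2 : 'cV[R]_L,
    normF (h J1 - h J2) <= beta / (1 - alpha) * normJ (J1 - J2).
Proof.
move=> F g T h gLip alpha01 Tcontr J1 J2.
have FT J f : F (T J f) by exact: traffic_assignment_feasible.
(* Existence of a fixed point rules out the default value 0 of [xget]. *)
have hfix J : F (h J) /\ T J (h J) = h J.
  have F0 : [set x : 'rV[R]_M |
      (forall m, 0 <= x 0 m) /\ 0 <= \sum_m x 0 m <= dmax] !=set0.
    exists 0; split=> [m|]; first by rewrite mxE.
    by rewrite big1 ?lexx ?ltW// => m _; rewrite mxE.
  have FE : F = _ := feasible_flowsE B dmax.
  have [f Ff Tf] : exists2 f, F f & T J f = f.
    rewrite FE.
    apply: (contraction_fixpoint_compact hnormF _ F0 _ alpha01); rewrite -?FE.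
    - exact: compact_route_flows.
    - by move=> f _; exact: FT.
    - exact: Tcontr.
  have : [set f | F f /\ incentive_map g C J f = f] !=set0.
    by exists f.
  by move/(@xgetPex _ 0).
have [Fh1 Th1] := hfix J1; have [Fh2 Th2] := hfix J2.
case/andP: alpha01 => _ alpha1.
have le_sum : normF (h J1 - h J2)
    <= alpha * normF (h J1 - h J2) + beta * normJ (J1 - J2).
  rewrite -{1}Th1 -{1}Th2.
  apply: (le_trans (is_norm_dist_triangle hnormF _ (T J1 (h J2)) _)).
  apply: lerD; first by apply: Tcontr.
  apply: (le_trans (gLip _ _)).
  (* Both costs are taken at the same flow [h J2], so they differ by [J1 - J2] exactly. *)
  by rewrite [C _ + J1]addrC addrKA.
rewrite mulrAC ler_pdivlMr ?subr_gt0//; lra.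
Qed.
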